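(* Let $K$ be a field with $\operatorname{char}K\neq 2$, and let $\mathbf Q$ be the Lie subsuperalgebra of $(\operatorname{End}\Lambda)^{(-)}$ generated by the pivot elements $v_0,v_1,v_2$ (notation in context). Then a basis of $\mathbf Q$ is given by the following standard monomials: (i) (first type) all $r_{n-3}v_n$, $n\ge 0$, where $r_{n-3}$ runs over all tail monomials, except the monomials $x_0x_1^{\xi_1}v_4$ (i.e. length $4$ monomials containing $x_0$) and $x_0x_1^{\xi_1}x_2^{\xi_2}x_3x_4^{\xi_4}v_7$ (i.e. length $7$ monomials containing both $x_0$ and $x_3$), $\xi_j\in\{0,1\}$; (ii) (second type) $x_1v_3,\ x_2v_4,\ x_3v_5$, together with all $r_{n-5}x_{n-2}v_n$, $n\ge 6$, where $r_{n-5}$ runs over all tail monomials, except the monomials $x_0x_1^{\xi_1}x_2^{\xi_2}x_5v_7$ and $x_0x_1^{\xi_1}x_2^{\xi_2}x_3x_4^{\xi_4}x_5x_8v_{10}$, $\xi_j\in\{0,1\}$.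
   Context: $\Lambda$ is the Grassmann algebra over $K$ on odd generators $x_0,x_1,\dots$; $x_i$ is identified with left multiplication by $x_i$ on $\Lambda$; $\partial_i$ is the odd superderivation with $\partial_i(x_j)=\delta_{ij}$. The pivot elements are $v_i=\sum_{k\ge0}\big(\prod_{n=0}^{k-1}x_{i+3n}x_{i+3n+1}\big)\partial_{i+3k}$ ($i\ge0$), well-defined odd superderivations of $\Lambda$. $(\operatorname{End}\Lambda)^{(-)}$ is the Lie superalgebra with supercommutator $[a,b]=ab-(-1)^{|a||b|}ba$. A tail monomial is $r_m=x_0^{\xi_0}x_1^{\xi_1}\cdots x_m^{\xi_m}$ with $\xi_i\in\{0,1\}$ (for $m<0$, $r_m=1$); the monomials above are compositions of operators in $\operatorname{End}\Lambda$. *)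

(* Defs.v *)
From HB Require Import structures.
From mathcomp Require Import all_boot all_order all_algebra.
From mathcomp Require Import finmap.
From mathcomp.multinomials Require Import monalg.


Unset Strict Implicit.
Unset Printing Implicit Defensive.

Import GRing.Theory.
Local Open Scope fset_scope.
Local Open Scope ring_scope.

(* Grassmann algebra over K on odd generators x_0, x_1, ... :
   the free K-module on finite subsets S of nat; the basis element for
   S = {s1 < ... < sk} is the monomial x_{s1} x_{s2} ... x_{sk}. *)
Definition Lam (K : fieldType) := {malg K[{fset nat}]}.

Definition xmon (K : fieldType) (S : {fset nat}) : Lam K := << S >>.

(* number of elements of S smaller than i: the sign exponent when moving
   x_i past the generators of x_S with smaller index *)
Definition nbelow (i : nat) (S : {fset nat}) : nat :=
  count (fun j => j < i)%N (enum_fset S).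

Definition lin_ext (K : fieldType) (f : {fset nat} -> Lam K) : Lam K -> Lam K :=
  fun p => \sum_(S <- msupp p) p@_S *: f S.

Definition xop (K : fieldType) (i : nat) : Lam K -> Lam K :=
  lin_ext K (fun S => if i \in S then 0
                    else (-1) ^+ (nbelow i S) *: xmon K (i |` S)).

(* the odd superderivation d_i with d_i(x_j) = delta_ij *)
Definition dop (K : fieldType) (i : nat) : Lam K -> Lam K :=
  lin_ext K (fun S => if i \in S then (-1) ^+ (nbelow i S) *: xmon K (S `\ i)
                    else 0).

Definition prodx (K : fieldType) (l : seq nat) : Lam K -> Lam K :=
  foldr (fun j f => xop K j \o f) id l.

Definition pivot_list (i k : nat) : seq nat :=
  flatten [seq [:: (i + 3 * n)%N; (i + 3 * n).+1] | n <- iota 0 k].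

(* pivot element v_i = sum_{k>=0} (prod_{n<k} x_{i+3n} x_{i+3n+1}) d_{i+3k}.
   On a basis monomial x_S only the terms with i+3k in S can be nonzero,
   so truncating the sum at k <= max S is exact. *)
Definition vop (K : fieldType) (i : nat) : Lam K -> Lam K :=
  lin_ext K (fun S => \sum_(k < (\max_(s <- enum_fset S) s).+1)
                     prodx K (pivot_list i k) (dop K (i + 3 * k) (xmon K S))).

(* supercommutator [a,b] = ab - (-1)^{|a||b|} ba of homogeneous operators
   of parities pa, pb (true = odd) *)
Definition sbr (K : fieldType) (pa pb : bool) (a b : Lam K -> Lam K)
  : Lam K -> Lam K :=
  fun p => a (b p) - (-1) ^+ (pa && pb) *: b (a p).

Inductive lword : Type :=
| LGen of 'I_3
| LBr of lword & lword.

Fixpoint lpar (w : lword) : bool :=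
  match w with
  | LGen _ => true
  | LBr a b => lpar a (+) lpar b
  end.

Fixpoint leval (K : fieldType) (w : lword) : Lam K -> Lam K :=
  match w with
  | LGen i => vop K (nat_of_ord i)
  | LBr a b => sbr K (lpar a) (lpar b) (leval K a) (leval K b)
  end.

(* standard monomials: (false, n, S) denotes r_{n-3} v_n (first type) and
   (true, n, S) denotes r_{n-5} x_{n-2} v_n (second type), where the tail
   monomial r is the product of x_s, s in S, in increasing order. *)
Definition std := (bool * nat * {fset nat})%type.

Definition std_op (K : fieldType) (j : std) : Lam K -> Lam K :=
  let: (t, n, T) := j in
  if t then prodx K (sort leq (enum_fset T)) \o xop K (n - 2) \o vop K n
  else prodx K (sort leq (enum_fset T)) \o vop K n.

Definition std_valid (j : std) : bool :=
  let: (t, n, T) := j in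
  if ~~ t then
    [&& all (fun s => s + 3 <= n)%N (enum_fset T),
        ~~ ((n == 4)%N && (0%N \in T)) &
        ~~ [&& n == 7, 0%N \in T & 3%N \in T]]
  else
    ((n \in [:: 3; 4; 5])%N && (T == fset0))
    || [&& (6 <= n)%N, all (fun s => s + 5 <= n)%N (enum_fset T),
           ~~ ((n == 7)%N && (0%N \in T)) &
           ~~ [&& n == 10, 0%N \in T, 3%N \in T & 5%N \in T]].

(* Main.v *)
Require Import Defs.
From HB Require Import structures.
From mathcomp Require Import all_boot all_order all_algebra.
From mathcomp Require Import finmap boolp zify.
From mathcomp.multinomials Require Import monalg.

Unset Strict Implicit.
Unset Printing Implicit Defensive.
Set Implicit Arguments.
Import GRing.Theory.
Local Open Scope fset_scope.
Local Open Scope ring_scope.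

(** Everything happens in the algebra of linear endomorphisms of [Lam K], where
    the multiplications [x_i], the derivations [d_i] and the pivots satisfy the
    Clifford relations, [v_i = d_i + x_i x_{i+1} v_{i+3}], and [v_n]
    anticommutes with [x_j] and [d_j] for [j < n].  This gives
      [{v_i, v_i} = 2 x_{i+1} v_{i+3}],  [{v_i, v_{i+1}} = - x_i v_{i+3}],
      [{v_i, v_{i+2}} = - x_i x_{i+1} x_{i+2} v_{i+5}],
      [{v_i, v_m} = x_i x_{i+1} {v_{i+3}, v_m}] for [m >= i + 3].

    Spanning: the span of the standard monomials is stable under [ad v_0],
    [ad v_1], [ad v_2], hence by the Jacobi identity under [ad] of every
    iterated bracket.

    Membership: [[v_i, x_i x_S v_m] = x_S v_m] when [i < m] is not in [S], so
    only the monomials that are maximal for fixed [m] are needed; these come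
    from brackets of the form
    [[x_S v_n, x_T v_m] = +- x_S x_T {v_n, v_m}] with [m - n <= 2].

    Independence: [v_n] maps [x_n] to [1] and [v_m] kills [x_n] for [m > n], so
    the coefficients vanish by induction on [n]. *)

(** * Linear endomorphisms of the Grassmann algebra *)

Section LinearExtension.
Variable K : fieldType.
Implicit Types (f : {fset nat} -> Lam K) (p : Lam K).

(** The supports of [p], [q] and [a *: p + q] differ, so linearity is checked on a common finite set
    containing all three. *)
Lemma lin_extEw f p (D : {fset {fset nat}}) :
  msupp p `<=` D -> lin_ext K f p = \sum_(S <- D) p@_S *: f S.
Proof.
move=> sub; rewrite /lin_ext; apply: big_fset_incl => // S _ nS.
by rewrite (mcoeff_outdom nS) scale0r.
Qed.

Lemma lin_ext_linear f : linear (lin_ext K f).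
Proof.
move=> a p q.
pose D := msupp (a *: p + q) `|` (msupp p `|` msupp q).
rewrite !(@lin_extEw _ _ D); first last.
- by rewrite /D fsubsetUl.
- by rewrite /D fsetUA [_ `|` msupp p]fsetUC -fsetUA fsubsetUl.
- by rewrite /D fsetUA fsubsetUr.
rewrite scaler_sumr -big_split; apply: eq_bigr => S _.
by rewrite mcoeffD mcoeffZ scalerDl scalerA.
Qed.

Lemma lin_ext_xmon f S : lin_ext K f (xmon K S) = f S.
Proof.
by rewrite /lin_ext msuppU oner_eq0 big_seq_fset1 mcoeffUU scale1r.
Qed.

Lemma xmon_sum p : p = \sum_(S <- msupp p) p@_S *: xmon K S.
Proof.
rewrite {1}[p]monalgE; apply: eq_bigr => S _.
by apply/malgP => T; rewrite mcoeffZ !mcoeffU mulr_natr.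
Qed.

End LinearExtension.

Record lend (K : fieldType) := Lend {
  lend_fun :> Lam K -> Lam K;
  lend_linear : linear lend_fun }.

Section EndAlgebra.
Variable K : fieldType.
Implicit Types a b c : lend K.

Lemma lendP a b : a =1 b -> a = b.
Proof.
case: a b => [f lf] [g lg] /= /funext e; move: lf lg; rewrite e => lf lg.
by rewrite (Prop_irrelevance lf lg).
Qed.

HB.instance Definition _ := gen_eqMixin (lend K).
HB.instance Definition _ := gen_choiceMixin (lend K).

Lemma lendDZ a (k : K) p q : a (k *: p + q) = k *: a p + a q.
Proof. exact: lend_linear. Qed.

Lemma lend_id_linear : linear (@id (Lam K)). Proof. by []. Qed.
Lemma lend_zero_linear : linear (fun _ : Lam K => 0 : Lam K).
Proof. by move=> k p q; rewrite scaler0 addr0. Qed.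
Lemma lend_opp_linear a : linear (fun p => - a p).
Proof. by move=> k p q; rewrite lendDZ opprD scalerN. Qed.
Lemma lend_add_linear a b : linear (fun p => a p + b p).
Proof. by move=> k p q; rewrite !lendDZ scalerDr addrACA. Qed.
Lemma lend_mul_linear a b : linear (fun p => a (b p)).
Proof. by move=> k p q; rewrite !lendDZ. Qed.
Lemma lend_scale_linear l a : linear (fun p => l *: a p).
Proof. by move=> k p q; rewrite lendDZ scalerDr !scalerA mulrC. Qed.

(* The operations are sealed by opaque proofs: otherwise unification compares
   two operators by unfolding them down to [lin_ext]. *)
Fact lend_zero_spec : {f : lend K | forall p, f p = 0}.
Proof. by exists (Lend lend_zero_linear). Qed.
Definition lend_zero := sval lend_zero_spec.
Fact lend_one_spec : {f : lend K | forall p, f p = p}.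
Proof. by exists (Lend lend_id_linear). Qed.
Definition lend_one := sval lend_one_spec.
Fact lend_opp_spec : {f : lend K -> lend K | forall a p, f a p = - a p}.
Proof. by exists (fun a => Lend (lend_opp_linear a)). Qed.
Definition lend_opp := sval lend_opp_spec.
Fact lend_add_spec : {f : lend K -> lend K -> lend K |
  forall a b p, f a b p = a p + b p}.
Proof. by exists (fun a b => Lend (lend_add_linear a b)). Qed.
Definition lend_add := sval lend_add_spec.
Fact lend_mul_spec : {f : lend K -> lend K -> lend K |
  forall a b p, f a b p = a (b p)}.
Proof. by exists (fun a b => Lend (lend_mul_linear a b)). Qed.
Definition lend_mul := sval lend_mul_spec.
Fact lend_scale_spec : {f : K -> lend K -> lend K |
  forall k a p, f k a p = k *: a p}.
Proof. by exists (fun k a => Lend (lend_scale_linear k a)). Qed.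
Definition lend_scale := sval lend_scale_spec.

Fact lend_zeroE0 p : lend_zero p = 0.
Proof. exact: (svalP lend_zero_spec). Qed.
Fact lend_oneE0 p : lend_one p = p.
Proof. exact: (svalP lend_one_spec). Qed.
Fact lend_oppE0 a p : lend_opp a p = - a p.
Proof. exact: (svalP lend_opp_spec). Qed.
Fact lend_addE0 a b p : lend_add a b p = a p + b p.
Proof. exact: (svalP lend_add_spec). Qed.
Fact lend_mulE0 a b p : lend_mul a b p = a (b p).
Proof. exact: (svalP lend_mul_spec). Qed.
Fact lend_scaleE0 k a p : lend_scale k a p = k *: a p.
Proof. exact: (svalP lend_scale_spec). Qed.
Let opE0 :=
  (lend_zeroE0, lend_oneE0, lend_oppE0, lend_addE0, lend_mulE0, lend_scaleE0).

Lemma lend_fun0 a : a 0 = 0.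
Proof. by have := lendDZ a (-1) 0 0; rewrite scaler0 add0r scaleN1r addNr. Qed.

Lemma lend_funD a p q : a (p + q) = a p + a q.
Proof. by rewrite -[p]scale1r lendDZ !scale1r. Qed.

Lemma lend_funZ a k p : a (k *: p) = k *: a p.
Proof. by rewrite -[X in a X]addr0 lendDZ lend_fun0 addr0. Qed.

Fact lend_addA : associative lend_add.
Proof. by move=> a b c; apply: lendP => p; rewrite !opE0 addrA. Qed.
Fact lend_addC : commutative lend_add.
Proof. by move=> a b; apply: lendP => p; rewrite !opE0 addrC. Qed.
Fact lend_add0 : left_id lend_zero lend_add.
Proof. by move=> a; apply: lendP => p; rewrite !opE0 add0r. Qed.
Fact lend_addN : left_inverse lend_zero lend_opp lend_add.
Proof. by move=> a; apply: lendP => p; rewrite !opE0 addNr. Qed.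

HB.instance Definition _ := GRing.isZmodule.Build (lend K)
  lend_addA lend_addC lend_add0 lend_addN.

Fact lend_mulA : associative lend_mul.
Proof. by move=> a b c; apply: lendP => p; rewrite !opE0. Qed.
Fact lend_mul1 : left_id lend_one lend_mul.
Proof. by move=> a; apply: lendP => p; rewrite !opE0. Qed.
Fact lend_mulr1 : right_id lend_one lend_mul.
Proof. by move=> a; apply: lendP => p; rewrite !opE0. Qed.
Fact lend_mulDl : left_distributive lend_mul lend_add.
Proof. by move=> a b c; apply: lendP => p; rewrite !opE0. Qed.
Fact lend_mulDr : right_distributive lend_mul lend_add.
Proof. by move=> a b c; apply: lendP => p; rewrite !opE0 lend_funD. Qed.
Fact lend_one_neq0 : lend_one != lend_zero.
Proof.
apply/eqP => /(congr1 (fun a : lend K => (a (xmon K fset0))@_fset0)) /=.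
by rewrite !opE0 mcoeffUU mcoeff0 => /eqP; rewrite oner_eq0.
Qed.

HB.instance Definition _ := GRing.Zmodule_isNzRing.Build (lend K)
  lend_mulA lend_mul1 lend_mulr1 lend_mulDl lend_mulDr lend_one_neq0.

Fact lend_scaleA k l a : lend_scale k (lend_scale l a) = lend_scale (k * l) a.
Proof. by apply: lendP => p; rewrite !opE0 scalerA. Qed.
Fact lend_scale1 : left_id 1 lend_scale.
Proof. by move=> a; apply: lendP => p; rewrite !opE0 scale1r. Qed.
Fact lend_scaleDr : right_distributive lend_scale lend_add.
Proof. by move=> k a b; apply: lendP => p; rewrite !opE0 scalerDr. Qed.
Fact lend_scaleDl a : {morph lend_scale^~ a : k l / k + l >-> lend_add k l}.
Proof. by move=> k l; apply: lendP => p; rewrite !opE0 scalerDl. Qed.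

HB.instance Definition _ := GRing.Zmodule_isLmodule.Build K (lend K)
  lend_scaleA lend_scale1 lend_scaleDr lend_scaleDl.

Fact lend_scaleAl k a b :
  lend_scale k (lend_mul a b) = lend_mul (lend_scale k a) b.
Proof. by apply: lendP => p; rewrite !opE0. Qed.

HB.instance Definition _ := GRing.Lmodule_isLalgebra.Build K (lend K)
  lend_scaleAl.

Fact lend_scaleAr k a b :
  lend_scale k (lend_mul a b) = lend_mul a (lend_scale k b).
Proof. by apply: lendP => p; rewrite !opE0 lend_funZ. Qed.

HB.instance Definition _ := GRing.Lalgebra_isAlgebra.Build K (lend K)
  lend_scaleAr.

Lemma lend_addE a b p : (a + b) p = a p + b p. Proof. exact: lend_addE0. Qed.
Lemma lend_oppE a p : (- a) p = - a p. Proof. exact: lend_oppE0. Qed.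
Lemma lend_mulE a b p : (a * b) p = a (b p). Proof. exact: lend_mulE0. Qed.
Lemma lend_scaleE k a p : (k *: a) p = k *: a p. Proof. exact: lend_scaleE0. Qed.
Lemma lend_zeroE p : (0 : lend K) p = 0. Proof. exact: lend_zeroE0. Qed.
Lemma lend_oneE p : (1 : lend K) p = p. Proof. exact: lend_oneE0. Qed.
Lemma lend_sumE I (r : seq I) (F : I -> lend K) p :
  (\sum_(i <- r) F i) p = \sum_(i <- r) F i p.
Proof.
elim: r => [|i r IH]; rewrite ?big_nil ?lend_zeroE //.
by rewrite !big_cons lend_addE IH.
Qed.
Lemma lend_fun_sum I (r : seq I) a (F : I -> Lam K) :
  a (\sum_(i <- r) F i) = \sum_(i <- r) a (F i).
Proof.
by elim: r => [|i r IH]; rewrite ?big_nil ?lend_fun0 // !big_cons lend_funD IH.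
Qed.

Lemma lend_xmonP a b : (forall S, a (xmon K S) = b (xmon K S)) -> a = b.
Proof.
move=> e; apply: lendP => p; rewrite [p]xmon_sum !lend_fun_sum.
by apply: eq_bigr => S _; rewrite !lend_funZ e.
Qed.

End EndAlgebra.

(** * Clifford relations between multiplications and derivations *)

Section Clifford.
Variable K : fieldType.

Fact opx_spec : {f : nat -> lend K | forall i p, f i p = xop K i p}.
Proof. by exists (fun i => @Lend K (xop K i) (lin_ext_linear _)). Qed.
Definition opx := sval opx_spec.
Local Notation x := opx.
Lemma opxE i p : x i p = xop K i p. Proof. exact: (svalP opx_spec). Qed.

Fact opd_spec : {f : nat -> lend K | forall i p, f i p = dop K i p}.
Proof. by exists (fun i => @Lend K (dop K i) (lin_ext_linear _)). Qed.
Definition opd := sval opd_spec.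
Local Notation d := opd.
Lemma opdE i p : d i p = dop K i p. Proof. exact: (svalP opd_spec). Qed.

Fact opv_spec : {f : nat -> lend K | forall i p, f i p = vop K i p}.
Proof. by exists (fun i => @Lend K (vop K i) (lin_ext_linear _)). Qed.
Definition opv := sval opv_spec.
Local Notation v := opv.
Lemma opvE i p : v i p = vop K i p. Proof. exact: (svalP opv_spec). Qed.

Lemma x_xmon i S : x i (xmon K S) =
  if i \in S then 0 else (-1) ^+ nbelow i S *: xmon K (i |` S).
Proof. by rewrite opxE; exact: lin_ext_xmon. Qed.

Lemma d_xmon i S : d i (xmon K S) =
  if i \in S then (-1) ^+ nbelow i S *: xmon K (S `\ i) else 0.
Proof. by rewrite opdE; exact: lin_ext_xmon. Qed.

Lemma nbelowD1 i j S : j \in S -> nbelow i S = ((j < i) + nbelow i (S `\ j))%N.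
Proof.
move=> jS; have /perm_to_rem e := jS.
rewrite /nbelow (seq.permP e) /=; congr (_ + _)%N; apply/seq.permP.
apply: uniq_perm; rewrite ?rem_uniq ?fset_uniq // => k.
by rewrite mem_rem_uniq ?fset_uniq // !inE.
Qed.

Lemma nbelowU1 i j S : j \notin S -> nbelow i (j |` S) = ((j < i) + nbelow i S)%N.
Proof. by move=> jS; rewrite (@nbelowD1 i j) ?fset1U1 // fsetU1K. Qed.

(** Source of all the anticommutation signs: of two distinct indices exactly one lies below the
    other, so the two orders of insertion or removal differ by one transposition. *)
Lemma ltn_sign (i j : nat) : i != j ->
  (-1) ^+ (i < j)%N = - (-1) ^+ (j < i)%N :> K.
Proof. by case: ltngtP => // _ _; rewrite ?opprK. Qed.

Lemma xx0 i : x i * x i = 0.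
Proof.
apply: lend_xmonP => S; rewrite lend_mulE x_xmon lend_zeroE.
by case: ifP => iS; rewrite ?lend_fun0 // lend_funZ x_xmon fset1U1 scaler0.
Qed.

Lemma xxC i j : x i * x j = - (x j * x i).
Proof.
have [-> | ne] := eqVneq i j; first by rewrite xx0 oppr0.
have ne' : j != i by rewrite eq_sym.
apply: lend_xmonP => S; rewrite lend_oppE !lend_mulE !x_xmon.
case: (boolP (i \in S)) => iS; case: (boolP (j \in S)) => jS;
  rewrite ?lend_fun0 ?lend_funZ ?x_xmon ?in_fset1U ?iS ?jS ?(negPf iS)
    ?(negPf jS) ?(negPf ne) ?(negPf ne') ?orbT ?scaler0 ?oppr0 //=.
rewrite !nbelowU1 // !exprD !scalerA.
rewrite (ltn_sign ne) fsetUCA -scaleNr; congr (_ *: _).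
by rewrite mulNr mulrN opprK mulrCA [RHS]mulrCA [_ * (-1) ^+ nbelow i S]mulrC.
Qed.

Lemma ddC i j : d i * d j = - (d j * d i).
Proof.
apply: lend_xmonP => S; rewrite lend_oppE !lend_mulE !d_xmon.
case: (boolP (i \in S)) => iS; case: (boolP (j \in S)) => jS;
  rewrite ?lend_fun0 ?oppr0 // ?lend_funZ ?d_xmon ?in_fsetD1 ?(negPf iS)
   ?(negPf jS) ?andbF ?scaler0 ?oppr0 // iS jS !andbT.
have [<- | ne] := eqVneq i j; rewrite ?eqxx ?scaler0 ?oppr0 //=.
have -> : S `\ j `\ i = S `\ i `\ j by apply/fsetP=> k; rewrite !inE andbCA.
rewrite !scalerA -scaleNr; congr (_ *: _).
rewrite (nbelowD1 j iS) (nbelowD1 i jS) !exprD (ltn_sign ne) !mulNr.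
by rewrite mulrAC.
Qed.

Lemma dx i j : d i * x j + x j * d i = (i == j)%:R.
Proof.
apply: lend_xmonP => S; rewrite lend_addE !lend_mulE x_xmon d_xmon.
have [<- | ne] /= := eqVneq i j.
  rewrite lend_oneE; case: (boolP (i \in S)) => iS;
    rewrite ?lend_fun0 ?addr0 ?add0r lend_funZ ?x_xmon ?d_xmon ?fset1U1
      ?fsetU1K ?in_fsetD1 ?eqxx /= ?scalerA ?nbelowU1 //.
    by rewrite (nbelowD1 i iS) ltnn add0n
      -signr_odd -signr_addb addbb scale1r fsetD1K.
  by rewrite ltnn add0n -signr_odd -signr_addb addbb scale1r.
rewrite lend_zeroE.
have ne' : j != i by rewrite eq_sym.
case: (boolP (i \in S)) => iS; case: (boolP (j \in S)) => jS;
  rewrite ?lend_fun0 ?lend_funZ ?x_xmon ?d_xmon ?in_fsetD1 ?in_fset1U ?iS ?jS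
   ?(negPf iS) ?(negPf jS) ?(negPf ne) ?(negPf ne') ?andbF /=
   ?scaler0 ?addr0 //.
have -> : (j |` S) `\ i = j |` (S `\ i).
  by apply/fsetP=> k; rewrite !inE; case: eqVneq => // ->; rewrite (negPf ne).
rewrite !scalerA nbelowU1 // (nbelowD1 j iS) !exprD (ltn_sign ne) -scalerDl.
by rewrite !mulNr mulrACA -signr_addb addbb mul1r mulrC addNr scale0r.
Qed.

End Clifford.

Section Pivots.
Variable K : fieldType.
Local Notation x := (opx K).
Local Notation d := (opd K).
Local Notation v := (opv K).

Definition xs (l : seq nat) : lend K := \prod_(i <- l) x i.

Lemma xs_nil : xs [::] = 1. Proof. exact: big_nil. Qed.
Lemma xs_cons i l : xs (i :: l) = x i * xs l. Proof. exact: big_cons. Qed.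
Lemma xs_cat l1 l2 : xs (l1 ++ l2) = xs l1 * xs l2. Proof. exact: big_cat. Qed.
Lemma xs1 i : xs [:: i] = x i. Proof. by rewrite xs_cons xs_nil mulr1. Qed.

Lemma xsE l p : xs l p = prodx K l p.
Proof.
elim: l p => [|i l IH] p; first by rewrite xs_nil lend_oneE.
by rewrite xs_cons lend_mulE opxE IH.
Qed.

Lemma pivot_listS i k :
  pivot_list i k.+1 = [:: i, i.+1 & pivot_list (i + 3) k].
Proof.
rewrite /pivot_list /= muln0 addn0; congr [:: _, _ & flatten _].
rewrite -[1%N]/(1 + 0)%N iotaDl -map_comp; apply: eq_map => n /=.
by congr [:: _; _]; lia.
Qed.

Lemma d_xmon_gt i S : (\max_(s <- enum_fset S) s < i)%N -> d i (xmon K S) = 0.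
Proof.
move=> lt; rewrite d_xmon ifN //; apply: contraL lt => iS.
by rewrite -leqNgt; apply: leq_bigmax_seq.
Qed.

(** Terms beyond the largest index of [S] vanish, so the truncation bound can be raised at will;
    this lets sums for different pivots be compared term by term. *)
Lemma v_xmon i S N : (\max_(s <- enum_fset S) s < N)%N ->
  v i (xmon K S) =
  \sum_(k < N) xs (pivot_list i k) (d (i + 3 * k) (xmon K S)).
Proof.
move=> lt; rewrite opvE /vop lin_ext_xmon.
pose F k := xs (pivot_list i k) (d (i + 3 * k) (xmon K S)).
rewrite (eq_bigr (F \o val)) => [|k _ /=]; last by rewrite /F xsE opdE.
rewrite -[RHS](big_mkord xpredT F) (big_cat_nat (leq0n _) lt) /=.
rewrite [X in _ + X]big1_seq ?addr0 ?big_mkord // => k /=.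
rewrite mem_index_iota => /andP[ltk _].
by rewrite /F d_xmon_gt ?lend_fun0 //; apply: leq_trans ltk _; lia.
Qed.

Lemma vS i : v i = d i + x i * (x i.+1 * v (i + 3)).
Proof.
apply: lend_xmonP => S; rewrite lend_addE !lend_mulE.
set M := (\max_(s <- enum_fset S) s)%N.
(* The bounds differ by one: once the term [k = 0] is split off on the left, both sums have the same
   length and match under the shift of [i] by 3. *)
rewrite (@v_xmon i S M.+2) // (@v_xmon (i + 3) S M.+1) // big_ord_recl /=.
rewrite muln0 addn0 {1}/pivot_list /= xs_nil lend_oneE !lend_fun_sum.
congr (_ + _); apply: eq_bigr => k _; rewrite /bump /= add1n pivot_listS.
by rewrite !xs_cons !lend_mulE; congr (x i (x _ (xs _ (d _ _)))); lia.
Qed.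

(** This makes the recursion [vS] terminate: on a fixed vector it only has to be unrolled finitely
    often. *)
Lemma v_eventually0 p : exists N, forall m, (N <= m)%N -> v m p = 0.
Proof.
exists (\max_(S <- msupp p) (\max_(s <- enum_fset S) s).+1)%N => m le_m.
rewrite [p]xmon_sum lend_fun_sum big_seq big1 // => S S_p.
rewrite lend_funZ (@v_xmon m S _ (leqnn _)) big1 ?scaler0 // => k _.
rewrite d_xmon_gt ?lend_fun0 //; apply: leq_trans (_ : m <= _)%N; last lia.
by apply: leq_trans le_m; apply: (leq_bigmax_seq S S_p isT).
Qed.

(** By [vS], the anticommutator of [y] with [v m] is [x m * x m.+1] times the one with [v (m + 3)].
    At a given [p] it vanishes for large [m], since late pivots kill both [p] and [y p]. *)
Lemma v_anticomm (y : lend K) n :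
    (forall j, (n <= j)%N -> y * x j = - (x j * y)) ->
    (forall j, (n <= j)%N -> y * d j = - (d j * y)) ->
  y * v n = - (v n * y).
Proof.
move=> yx yd.
have yxA j z : (n <= j)%N -> y * (x j * z) = - (x j * (y * z)).
  by move=> ?; rewrite mulrA yx // mulNr -mulrA.
have step m : (n <= m)%N ->
    y * v m + v m * y = x m * (x m.+1 * (y * v (m + 3) + v (m + 3) * y)).
  move=> le_nm; rewrite {1 2}vS mulrDr mulrDl yd // !yxA ?mulrN ?opprK //; last lia.
  by rewrite addrACA addNr add0r !mulrDr -!mulrA.
apply/eqP; rewrite -addr_eq0; apply/eqP/lendP => p; rewrite lend_zeroE.
have [N1 v1] := v_eventually0 p; have [N2 v2] := v_eventually0 (y p).
have van k m : (N1 + N2 <= m + 3 * k)%N -> (n <= m)%N ->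
    (y * v m + v m * y) p = 0.
  elim: k m => [|k IH] m le le_nm.
    by rewrite lend_addE !lend_mulE v1 ?v2 ?lend_fun0 ?addr0 //; lia.
  by rewrite step // !lend_mulE IH ?lend_fun0 //; lia.
by apply: (van (N1 + N2)%N) => //; lia.
Qed.

Lemma xv j n : (j < n)%N -> x j * v n = - (v n * x j).
Proof.
move=> ltjn; apply: v_anticomm => i le_ni; first exact: xxC.
have := dx K i j; rewrite gtn_eqF; last lia.
by move/eqP; rewrite addrC addr_eq0 => /eqP.
Qed.

Lemma dv j n : (j < n)%N -> d j * v n = - (v n * d j).
Proof.
move=> ltjn; apply: v_anticomm => i le_ni; last exact: ddC.
have := dx K j i; rewrite ltn_eqF; last lia.
by move/eqP; rewrite addr_eq0 => /eqP.
Qed.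

End Pivots.

(** * Brackets of pivots and of monomials *)

Section Relations.
Variable K : fieldType.
Local Notation x := (opx K).
Local Notation d := (opd K).
Local Notation v := (opv K).
Local Notation xs := (xs K).
Implicit Types a b c z : lend K.

Lemma dd0 i : d i * d i = 0.
Proof.
apply: lend_xmonP => S; rewrite lend_mulE d_xmon lend_zeroE.
by case: ifP => iS; rewrite ?lend_fun0 // lend_funZ d_xmon !inE eqxx scaler0.
Qed.

Lemma xxA i j z : x i * (x j * z) = - (x j * (x i * z)).
Proof. by rewrite mulrA xxC mulNr -mulrA. Qed.

Lemma xx0A i z : x i * (x i * z) = 0.
Proof. by rewrite mulrA xx0 mul0r. Qed.

Lemma vx j n : (j < n)%N -> v n * x j = - (x j * v n).
Proof. by move/xv->; rewrite opprK. Qed.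

Lemma vxA j n z : (j < n)%N -> v n * (x j * z) = - (x j * (v n * z)).
Proof. by move=> lt; rewrite mulrA vx // mulNr -mulrA. Qed.

Definition anti i j := v i * v j + v j * v i.
(** Multiplication by the value of the superderivation [v i] on the generator of index [j]. *)
Definition contr i j := v i * x j + x j * v i.

Lemma antiC i j : anti i j = anti j i.
Proof. exact: addrC. Qed.

Lemma contr_lt i j : (j < i)%N -> contr i j = 0.
Proof. by move=> lt; rewrite /contr vx // addNr. Qed.

Lemma contrS i j :
  contr i j = (i == j)%:R + x i * (x i.+1 * contr (i + 3) j).
Proof.
rewrite /contr {1 2}vS mulrDl mulrDr addrACA dx; congr (_ + _).
by rewrite [x j * _]xxA [x j * _]xxA mulrN opprK !mulrDr -!mulrA.
Qed.

Lemma contr_pivot i k : contr i (i + 3 * k) = xs (pivot_list i k).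
Proof.
elim: k i => [|k IH] i.
  by rewrite muln0 addn0 contrS eqxx contr_lt ?mulr0 ?addr0 ?xs_nil //; lia.
rewrite contrS ltn_eqF ?add0r; last lia.
by rewrite pivot_listS !xs_cons -IH; congr (x i * (x _ * contr _ _)); lia.
Qed.

Lemma contr_pivot0 i k r : (0 < r < 3)%N -> contr i (i + 3 * k + r) = 0.
Proof.
move=> hr; elim: k i => [|k IH] i; rewrite contrS ltn_eqF ?add0r; try lia.
  by rewrite contr_lt ?mulr0 //; lia.
rewrite (_ : i + _ + r = i + 3 + 3 * k + r)%N ?IH ?mulr0 //; lia.
Qed.

Lemma contr_ndvd i j : ~~ (3 %| j - i)%N -> contr i j = 0.
Proof.
move=> nd; rewrite (_ : j = i + 3 * ((j - i) %/ 3) + (j - i) %% 3)%N; last lia.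
by apply: contr_pivot0; lia.
Qed.

Lemma vx_id i : v i * x i = 1 - x i * v i.
Proof.
have := contr_pivot i 0; rewrite muln0 addn0 xs_nil => <-.
by rewrite /contr addrK.
Qed.

Lemma anti_ltE i m : (i < m)%N ->
  anti i m = x i * (x i.+1 * (v (i + 3) * v m) - v m * (x i.+1 * v (i + 3))).
Proof.
move=> lt; rewrite /anti {1 2}vS mulrDl mulrDr addrACA dv // addNr add0r.
by rewrite vxA // mulrBr -!mulrA.
Qed.

Lemma x_anti i m : (i < m)%N -> x i * anti i m = 0.
Proof. by move=> lt; rewrite anti_ltE // xx0A. Qed.

(** With both factors expanded by [vS], the square of the tail contains [x i] twice and vanishes; of
    the cross terms only the contraction of [d i] with [x i] survives. *)
Lemma anti_id i : v i * v i = x i.+1 * v (i + 3).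
Proof.
have dxA j z : d i * (x j * z) = (i == j)%:R * z - x j * (d i * z).
  by rewrite -(dx K i j) mulrDl -!mulrA addrK.
have e : x i * (x i.+1 * (v (i + 3) * (x i * (x i.+1 * v (i + 3))))) = 0.
  rewrite [v _ * _]vxA; last lia.
  by rewrite [x i.+1 * - _]mulrN -xxA xx0A.
rewrite {1 2}vS mulrDl !mulrDr dd0 add0r -!mulrA e addr0.
rewrite dxA dxA eqxx ltn_eqF // mul1r mul0r sub0r dv; last lia.
by rewrite !mulrN opprK addrNK.
Qed.

Lemma anti1 i : anti i i.+1 = - (x i * v (i + 3)).
Proof.
rewrite anti_ltE // [v i.+1 * (_ * _)]mulrA vx_id mulrBl mul1r opprB.
(* The two terms quadratic in the pivots add up to [x i.+1 * anti i.+1 (i + 3)], which is zero. *)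
have := @x_anti i.+1 (i + 3); rewrite /anti mulrDr -mulrA addrCA addrA => -> //.
  by rewrite sub0r mulrN.
by lia.
Qed.

(** As soon as [m] exceeds [i.+1], [v m] anticommutes with [x i.+1] too, and the prefix factors out.
    Iteration reduces every anticommutator to a gap of 0, 1 or 2. *)
Lemma antiS i m : (i.+1 < m)%N ->
  anti i m = x i * (x i.+1 * anti (i + 3) m).
Proof.
by move=> lt; rewrite anti_ltE ?vxA ?opprK -?mulrDr //; lia.
Qed.

Lemma anti2 i : anti i i.+2 = - (x i * (x i.+1 * (x i.+2 * v (i + 5)))).
Proof.
rewrite antiS // antiC addn3 anti1 !mulrN.
by congr (- (_ * (_ * (_ * v _)))); lia.
Qed.

Lemma anti_pivot i k m : (i + 3 * k <= m)%N ->
  anti i m = xs (pivot_list i k) * anti (i + 3 * k) m.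
Proof.
elim: k i => [|k IH] i le; first by rewrite muln0 addn0 xs_nil mul1r.
rewrite antiS; last lia.
rewrite pivot_listS !xs_cons -!mulrA (IH (i + 3)%N); last lia.
by congr (_ * (_ * (_ * anti _ _))); lia.
Qed.

Lemma xs_v l n : all (fun j => j < n)%N l ->
  v n * xs l = (-1) ^+ size l *: (xs l * v n).
Proof.
elim: l => [|j l IH] /=; first by rewrite xs_nil mulr1 mul1r scale1r.
move=> /andP[lt /IH e]; rewrite !xs_cons vxA // e exprS -scalerA scaleN1r.
by rewrite -scalerAr mulrA.
Qed.

Lemma x_xs i l : x i * xs l = (-1) ^+ size l *: (xs l * x i).
Proof.
elim: l => [|j l IH] /=; first by rewrite xs_nil mulr1 mul1r scale1r.
rewrite !xs_cons xxA IH exprS -scalerA scaleN1r.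
by rewrite -scalerAr mulrA.
Qed.

Lemma xsC l1 l2 :
  xs l1 * xs l2 = (-1) ^+ (size l1 * size l2) *: (xs l2 * xs l1).
Proof.
elim: l1 => [|j l IH] /=; first by rewrite xs_nil mulr1 mul1r scale1r.
rewrite xs_cons -mulrA IH -scalerAr [x j * (_ * _)]mulrA x_xs -scalerAl -mulrA.
by rewrite scalerA -exprD mulSn addnC.
Qed.

(** The sign stays existential because spans are insensitive to it. *)
Lemma xs_perm l1 l2 : perm_eq l1 l2 -> exists k : nat,
  xs l2 = (-1) ^+ k *: xs l1.
Proof.
move=> e12; apply: (@catCA_perm_ind _
  (fun l => exists k : nat, xs l = (-1) ^+ k *: xs l1) _ l1 l2 e12).
  move=> s1 s2 s3 [k e]; exists (size s2 * size s1 + k)%N.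
  by rewrite !xs_cat mulrA xsC -scalerAl -mulrA -!xs_cat e scalerA exprD.
by exists 0%N; rewrite scale1r.
Qed.

Lemma xs_nuniq l : ~~ uniq l -> xs l = 0.
Proof.
elim: l => [//|i l IH] /=; rewrite negb_and negbK xs_cons.
case/orP => [il | /IH ->]; last by rewrite mulr0.
have [k ->] := xs_perm (etrans (perm_sym _ _) (perm_to_rem il)).
by rewrite xs_cons -scalerAr xx0A scaler0.
Qed.

Definition br (pa pb : bool) a b : lend K :=
  a * b - (-1) ^+ (pa && pb) *: (b * a).

Lemma brDr pa pb a b1 b2 : br pa pb a (b1 + b2) = br pa pb a b1 + br pa pb a b2.
Proof. by rewrite /br mulrDr mulrDl scalerDr opprD addrACA. Qed.
Lemma brDl pa pb a b1 b2 : br pa pb (b1 + b2) a = br pa pb b1 a + br pa pb b2 a.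
Proof. by rewrite /br mulrDr mulrDl scalerDr opprD addrACA. Qed.
Lemma brZr pa pb a k b : br pa pb a (k *: b) = k *: br pa pb a b.
Proof. by rewrite /br -scalerAr -scalerAl scalerBr !scalerA mulrC. Qed.
Lemma brZl pa pb a k b : br pa pb (k *: b) a = k *: br pa pb b a.
Proof. by rewrite /br -scalerAr -scalerAl scalerBr !scalerA mulrC. Qed.
Lemma br0r pa pb a : br pa pb a 0 = 0.
Proof. by rewrite /br mulr0 mul0r scaler0 subr0. Qed.
Lemma br0l pa pb a : br pa pb 0 a = 0.
Proof. by rewrite /br mulr0 mul0r scaler0 subr0. Qed.

Lemma jacobi pa pb pc a b c :
  br (pa (+) pb) pc (br pa pb a b) c =
  br pa (pb (+) pc) a (br pb pc b c)
  - (-1) ^+ (pa && pb) *: br pb (pa (+) pc) b (br pa pc a c).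
Proof.
pose s (b : bool) : K := (-1) ^+ b; rewrite /br -!/(s _).
have ss (b1 b2 : bool) : s b1 * s b2 = s (b1 (+) b2) by rewrite /s signr_addb.
rewrite !(mulrBl, mulrBr) -!(scalerAl, scalerAr) !scalerBr !scalerA -!mulrA !ss.
have [-> -> -> ->] : [/\ (pa && pb) (+) (pb && (pa (+) pc)) = pb && pc,
    (pa && pb) (+) (pa && pc) = pa && (pb (+) pc),
    pa && (pb (+) pc) (+) pb && pc = (pa (+) pb) && pc (+) pa && pb &
    (pa && pb) (+) (pb && (pa (+) pc) (+) pa && pc) = (pa (+) pb) && pc].
  by case: pa; case: pb; case: pc.
(* Of the eight terms on the right, 1, 8, 3 and 6 are those of the left side; the pairs 2, 5 and 4,
   7 cancel. *)
rewrite !opprB !addrA [RHS](ACl (1 * 8 * 3 * 6 * (2 * 5) * (4 * 7))) /=.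
by rewrite !addNr !addr0.
Qed.

Definition mon l n := xs l * v n.

(** The bounds let each pivot pass the other tail up to sign, so both products acquire the factor
    [xs (l1 ++ l2)]. A monomial has one odd factor more than its tail has letters, whence the
    parities [~~ odd]. *)
Lemma br_mon l1 n l2 m :
  all (fun j => j < m)%N l1 -> all (fun j => j < n)%N l2 ->
  br (~~ odd (size l1)) (~~ odd (size l2)) (mon l1 n) (mon l2 m) =
  (-1) ^+ size l2 *: (xs (l1 ++ l2) * anti n m).
Proof.
move=> lt1 lt2; rewrite /br /mon.
have -> : xs l1 * v n * (xs l2 * v m) =
    (-1) ^+ size l2 *: (xs (l1 ++ l2) * (v n * v m)).
  by rewrite mulrA -[xs l1 * _ * _]mulrA xs_v // -scalerAr -!scalerAl xs_cat !mulrA.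
have -> : xs l2 * v m * (xs l1 * v n) =
    (-1) ^+ (size l1 + size l2 * size l1) *:
    (xs (l1 ++ l2) * (v m * v n)).
  rewrite mulrA -[xs l2 * _ * _]mulrA xs_v // -scalerAr -!scalerAl -!mulrA.
  by rewrite [xs l2 * _]mulrA xsC -!scalerAl scalerA -exprD xs_cat !mulrA.
rewrite scalerA -scaleNr /anti mulrDr scalerDr; congr (_ + _ *: _).
rewrite -![(-1) ^+ (size _ + _)]signr_odd -![(-1) ^+ size _]signr_odd oddD oddM.
by case: odd; case: odd => //=; rewrite ?mulN1r ?mul1r ?opprK.
Qed.

(** Multiplication by the image of the monomial [xs l] under the superderivation [v i];
    [superder_cons] is its signed Leibniz rule. *)
Definition superder i l := v i * xs l - (-1) ^+ size l *: (xs l * v i).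

Lemma superder_nil i : superder i [::] = 0.
Proof. by rewrite /superder xs_nil mulr1 mul1r scale1r subrr. Qed.

Lemma superder_cons i j l : superder i (j :: l) =
  contr i j * xs l - x j * superder i l.
Proof.
rewrite /superder /contr xs_cons /= mulrDl mulrBr -!mulrA -scalerAr opprB -addrA.
by rewrite [x j * _ + _]addrC addrNK exprS -scalerA scaleN1r opprK.
Qed.

Lemma br_v i l m : br true (~~ odd (size l)) (v i) (mon l m) =
  superder i l * v m + (-1) ^+ size l *: (xs l * anti i m).
Proof.
rewrite /br /superder /mon mulrBl -!mulrA -scalerAl -!mulrA /anti mulrDr.
rewrite scalerDr addrA addrNK.
congr (_ + _); rewrite -scaleNr; congr (_ *: _).
by rewrite -[RHS]signr_odd; case: odd; rewrite ?opprK.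
Qed.

Lemma d_xs i l : i \notin l -> d i * xs l = (-1) ^+ size l *: (xs l * d i).
Proof.
elim: l => [|j l IH] /=; first by rewrite xs_nil mulr1 mul1r scale1r.
rewrite inE negb_or => /andP[ne /IH e]; rewrite !xs_cons.
have := dx K i j; rewrite (negPf ne) => /eqP; rewrite addr_eq0 => /eqP dxj.
by rewrite mulrA dxj mulNr -!mulrA e exprS -scalerA scaleN1r -scalerAr.
Qed.

(** In the Leibniz expansion, the term with [anti i m] contains [x i] twice. The term where [v i]
    acts on [l] vanishes as well: the leading [x i] kills the tail of [v i], and [d i] supercommutes
    with the letters of [l]. What remains is the contraction of [v i] with [x i]. *)
Lemma br_remove i l m : (i < m)%N -> i \notin l ->
  br true (odd (size l)) (v i) (mon (i :: l) m) = mon l m.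
Proof.
move=> lt il; have := br_v i (i :: l) m; rewrite /= negbK => ->.
have xxs z : x i * (xs l * (x i * z)) = 0.
  by rewrite mulrA x_xs -scalerAl -mulrA xx0A mulr0 scaler0.
have xD : x i * superder i l = 0.
  rewrite /superder vS mulrBr mulrDl !mulrDr -scalerAr mulrDr xxs addr0.
  by rewrite -[x i * _ * _]mulrA xx0A addr0 d_xs // -scalerAr subrr.
rewrite superder_cons xD subr0 xs_cons anti_ltE //.
rewrite -[x i * xs l * _]mulrA xxs scaler0 addr0.
by rewrite /contr vx_id addrNK mul1r.
Qed.

End Relations.

(** * Spans and standard monomials *)

Section Span.
Variables (K : fieldType) (I : Type) (F : I -> lend K) (P : pred I).
Local Notation v := (opv K).
Local Notation xs := (xs K).
Implicit Types a b c z : lend K.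

Definition lspan a := exists s : seq (K * I),
  all (fun w => P w.2) s /\ a = \sum_(w <- s) w.1 *: F w.2.

Lemma span0 : lspan 0.
Proof. by exists [::]; rewrite big_nil. Qed.

Lemma spanD a b : lspan a -> lspan b -> lspan (a + b).
Proof.
move=> [s [Ps ->]] [t [Pt ->]]; exists (s ++ t).
by rewrite all_cat Ps Pt big_cat.
Qed.

Lemma spanZ k a : lspan a -> lspan (k *: a).
Proof.
move=> [s [Ps ->]]; exists [seq (k * w.1, w.2) | w <- s].
rewrite all_map Ps scaler_sumr big_map; split=> //.
by apply: eq_bigr => w _; rewrite scalerA.
Qed.

Lemma spanN a : lspan a -> lspan (- a).
Proof. by rewrite -scaleN1r; apply: spanZ. Qed.

Lemma spanZ_inv k a : k != 0 -> lspan (k *: a) -> lspan a.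
Proof.
by move=> nz /(spanZ k^-1); rewrite scalerA mulVf // scale1r.
Qed.

Lemma span_sign k a : lspan ((-1) ^+ k *: a) -> lspan a.
Proof. by apply: spanZ_inv; rewrite signr_eq0. Qed.

Lemma span_gen i : P i -> lspan (F i).
Proof. by exists [:: (1, i)]; rewrite /= H big_seq1 scale1r. Qed.

Lemma span_ind (Q : lend K -> Prop) : Q 0 ->
    (forall a b, Q a -> Q b -> Q (a + b)) -> (forall k a, Q a -> Q (k *: a)) ->
    (forall i, P i -> Q (F i)) -> forall a, lspan a -> Q a.
Proof.
move=> Q0 QD QZ Qg a [s [+ ->]]; elim: s => [|w s IH]; first by rewrite big_nil.
by move=> /andP[/Qg Pw /IH Qs]; rewrite big_cons; apply: QD => //; apply: QZ.
Qed.

Lemma span_mon_perm l1 l2 n :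
  perm_eq l1 l2 -> lspan (mon K l1 n) -> lspan (mon K l2 n).
Proof.
by move=> /(xs_perm K)[k e]; rewrite /mon e -scalerAl; apply: spanZ.
Qed.

(** The Leibniz rule replaces one letter [j] at a time by its pivot list, and only letters [j >= i]
    congruent to [i] modulo 3 contribute. [pre] collects the letters already passed in the
    induction. *)
Lemma span_superder i pre l z :
    (forall l1 j l2, l = l1 ++ j :: l2 -> (i <= j)%N -> (3 %| j - i)%N ->
       lspan (xs (pre ++ l1 ++ pivot_list i ((j - i) %/ 3) ++ l2) * z)) ->
  lspan (xs pre * superder K i l * z).
Proof.
elim: l pre => [|j l IH] pre hyp.
  by rewrite superder_nil mulr0 mul0r; apply: span0.
rewrite superder_cons mulrBr mulrBl; apply: spanD.
  have [lt | le] := ltnP j i.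
    by rewrite contr_lt // mul0r mulr0 mul0r; apply: span0.
  have [dv | nd] := boolP (3 %| j - i)%N; last first.
    by rewrite contr_ndvd // mul0r mulr0 mul0r; apply: span0.
  have := hyp [::] j l erefl le dv; rewrite /= !xs_cat -contr_pivot.
  by rewrite mulnC divnK // subnKC.
apply: spanN; rewrite mulrA -xs1 -xs_cat; apply: IH => l1 j' l2 el le dv.
by rewrite -catA; apply: (hyp (j :: l1)) => //; rewrite el.
Qed.

End Span.

Lemma mem_pivot_list s i k :
  (s \in pivot_list i k) = 
  [&& i <= s, s + 2 <= i + 3 * k & (s - i) %% 3 != 2]%N.
Proof.
elim: k i => [|k IH] i; first by rewrite in_nil; lia.
by rewrite pivot_listS !inE IH; lia.
Qed.

Lemma odd_size_pivot_list i k : odd (size (pivot_list i k)) = false.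
Proof. by elim: k i => [//|k IH] i; rewrite pivot_listS /= IH. Qed.

(** * Standard monomials as lists of letters *)

Definition first_ok (l : seq nat) n :=
  [/\ {in l, forall s, s + 3 <= n}%N, n = 4%N -> 0%N \notin l &
      n = 7%N -> 0%N \in l -> 3%N \in l -> False].

(** Here [l] is the tail without the distinguished letter [n - 2]; the clause for small [n] leaves
    exactly [x_1 v_3], [x_2 v_4], [x_3 v_5]. *)
Definition second_ok (l : seq nat) n :=
  [/\ (2 < n)%N, (n <= 5)%N -> l = [::], {in l, forall s, s + 5 <= n}%N,
      n = 7%N -> 0%N \notin l &
      n = 10%N -> 0%N \in l -> 3%N \in l -> 5%N \in l -> False].

Definition ok (l : seq nat) n :=
  first_ok l n \/ exists2 T, l = T ++ [:: n - 2]%N & second_ok T n.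

Definition std_list (j : std) : seq nat :=
  let: (t, n, T) := j in
  sort leq (enum_fset T) ++ (if t then [:: n - 2]%N else [::]).

Lemma std_list_uniq j : std_valid j -> uniq (std_list j).
Proof.
case: j => [[[] n] T] /=; last by rewrite cats0 sort_uniq fset_uniq.
move=> val; rewrite cat_uniq sort_uniq fset_uniq /= orbF mem_sort andbT.
case/orP: val => [/andP[_ /eqP ->]|]; first by rewrite inE.
by case/and4P => n6 /allP le _ _; apply/negP => /le /=; lia.
Qed.

Lemma std_valid1P n T : 
  std_valid (false, n, T) <-> first_ok (sort leq (enum_fset T)) n.
Proof.
rewrite /= /first_ok; split.
  case/and3P => /allP h1 h2 h3; split.
  - by move=> s; rewrite mem_sort; apply: h1.
  - by move=> n4; rewrite mem_sort; rewrite n4 in h2.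
  - by move=> n7; rewrite !mem_sort => T0 T3; rewrite n7 T0 T3 in h3.
case=> h1 h2 h3; apply/and3P; split.
- by apply/allP => s sT; apply: h1; rewrite mem_sort.
- by apply/negP => /andP[/eqP /h2]; rewrite mem_sort => /negP.
- by apply/negP => /and3P[/eqP /h3]; rewrite !mem_sort => h /h.
Qed.

Lemma std_valid2P n T : 
  std_valid (true, n, T) <-> second_ok (sort leq (enum_fset T)) n.
Proof.
rewrite /= /second_ok; split.
  case/orP => [/andP[n3 /eqP ->]|].
    by rewrite !inE in n3; split=> //; move: n3; lia.
  case/and4P => n6 /allP h1 h2 h3; split.
  - by lia.
  - by lia.
  - by move=> s; rewrite mem_sort; apply: h1.
  - by move=> n7; rewrite mem_sort; rewrite n7 in h2.
  - by move=> n10; rewrite !mem_sort => T0 T3 T5; rewrite n10 T0 T3 T5 in h3.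
case=> h0 h0' h1 h2 h3; have [n5 | n6] := leqP n 5.
  apply/orP; left; apply/andP; split; first by rewrite !inE; lia.
  have e := h0' n5; apply/eqP/fsetP => s; rewrite inE.
  by rewrite -(mem_sort leq (enum_fset T)) e.
apply/orP; right; apply/and4P; split=> //.
- by apply/allP => s sT; apply: h1; rewrite mem_sort.
- by apply/negP => /andP[/eqP /h2]; rewrite mem_sort => /negP.
- by apply/negP => /and4P[/eqP /h3]; rewrite !mem_sort => h a b c; case: (h a b c).
Qed.

Lemma std_ok j : std_valid j -> ok (std_list j) j.1.2.
Proof.
case: j => [[[] n] T] /=; first by move/std_valid2P; right; eexists.
by move/std_valid1P; rewrite cats0; left.
Qed.

Lemma ok_le l n : ok l n -> {in l, forall s, s + 2 <= n}%N.
Proof.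
case=> [[h _ _] s /h | [T -> [n3 _ h _ _]] s]; first lia.
by rewrite mem_cat inE => /orP[/h|/eqP ->]; lia.
Qed.

Lemma ok_small l n : (n <= 2)%N -> ok l n -> l = [::].
Proof.
move=> n2 [[h _ _]|[T _ [n3 _ _ _ _]]]; last lia.
by case: l h => [//|s l] /(_ s (mem_head _ _)); lia.
Qed.

(** * The span of the standard monomials, graded by parity *)

Section StdSpan.
Variable K : fieldType.
Local Notation x := (opx K).
Local Notation v := (opv K).
Local Notation xs := (xs K).
Local Notation mon := (mon K).

Definition stdA (j : std) : lend K := mon (std_list j) j.1.2.
Definition std_par (j : std) : bool := ~~ odd (size (std_list j)).

Lemma stdAE j p : stdA j p = std_op K j p.
Proof.
case: j => [[[] n] T]; rewrite /stdA /mon /std_op lend_mulE /=.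
  by rewrite xs_cat lend_mulE xs1 xsE opxE opvE.
by rewrite cats0 xsE opvE.
Qed.

Definition std_span p := lspan stdA (fun j => std_valid j && (std_par j == p)).

(** A repeated letter makes the monomial zero and reordering costs only a sign, so the conditions
    are asked of duplicate-free lists in any order. *)
Lemma std_span_first l n p : (uniq l -> first_ok l n) ->
  p = ~~ odd (size l) -> std_span p (mon l n).
Proof.
move=> okl ->; have [ul | nu] := boolP (uniq l); last first.
  by rewrite /mon xs_nuniq // mul0r; apply: span0.
pose T := [fset s in l]%fset.
have eT : perm_eq (sort leq (enum_fset T)) l.
  rewrite perm_sort; apply: uniq_perm; rewrite ?fset_uniq // => s.
  by rewrite /T in_fset.
have := @span_gen _ _ stdA (fun j => std_valid j && (std_par j == ~~ odd (size l)))
  (false, n, T).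
rewrite /stdA /std_par /std_list cats0 (perm_size eT) eqxx andbT => h.
apply: (span_mon_perm eT); apply: h; apply/std_valid1P.
have [h1 h2 h3] := okl ul; split.
- by move=> s; rewrite (perm_mem eT); apply: h1.
- by rewrite (perm_mem eT).
- by rewrite !(perm_mem eT).
Qed.

Lemma std_span_second l n p : (uniq (l ++ [:: n - 2])%N -> second_ok l n) ->
  p = odd (size l) ->
  std_span p (mon (l ++ [:: n - 2])%N n).
Proof.
move=> okl ->; have [ul | nu] := boolP (uniq (l ++ [:: n - 2]%N)); last first.
  by rewrite /mon xs_nuniq // mul0r; apply: span0.
pose T := [fset s in l]%fset.
have eT : perm_eq (sort leq (enum_fset T)) l.
  have ul' : uniq l by move: ul; rewrite cat_uniq => /andP[].
  rewrite perm_sort; apply: uniq_perm; rewrite ?fset_uniq // => s.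
  by rewrite /T in_fset.
have := @span_gen _ _ stdA (fun j => std_valid j && (std_par j == odd (size l)))
  (true, n, T).
rewrite /stdA /std_par /std_list size_cat addn1 /= negbK (perm_size eT).
rewrite eqxx andbT => h.
have eT' : perm_eq (sort leq (enum_fset T) ++ [:: n - 2]%N) (l ++ [:: n - 2]%N).
  by rewrite perm_cat2r.
apply: (span_mon_perm eT'); apply: h; apply/std_valid2P.
have [h0 h0' h1 h2 h3] := okl ul; split=> //.
- by move=> /h0' e; apply/perm_nilP; rewrite -e.
- by move=> s; rewrite (perm_mem eT); apply: h1.
- by rewrite (perm_mem eT).
- by rewrite !(perm_mem eT).
Qed.

End StdSpan.

(** * Closure of the standard monomials under brackets *)

Section Closure.
Variable K : fieldType.
Local Notation x := (opx K).
Local Notation v := (opv K).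
Local Notation xs := (xs K).
Local Notation mon := (mon K).
Local Notation anti := (anti K).
Local Notation std_span := (@std_span K).

(** The residue of [m - i] modulo 3 decides the outcome: 0 gives second type of length [m + 3], 1
    gives first type of length [m + 2], 2 gives first type of length [m + 3]. The work lies in
    ruling out the exceptional monomials. *)
Lemma anti_std_span i m U : (i < 3)%N -> (i <= m)%N -> ok U m ->
  std_span (odd (size U)) (xs U * anti i m).
Proof.
move=> i3 le_im okU; have leU := ok_le okU.
pose q := ((m - i) %/ 3)%N; pose r := ((m - i) %% 3)%N.
have em : m = (i + 3 * q + r)%N by rewrite /q /r; lia.
have r3 : (r < 3)%N by rewrite ltn_mod.
clearbody q r; rewrite (@anti_pivot _ i q m) ?mulrA -?xs_cat; last lia.
have U0 : m = 4%N -> 0%N \notin U.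
  move=> m4; case: okU => [[_ h _]|[T -> [_ h _ _ _]]]; first exact: h.
  by rewrite h ?m4.
have szU : odd (size (U ++ pivot_list i q)) = odd (size U).
  by rewrite size_cat oddD odd_size_pivot_list addbF.
have leP s : s \in U ++ pivot_list i q -> (s + 2 <= m)%N.
  by rewrite mem_cat mem_pivot_list => /orP[/leU //|]; lia.
case: r r3 em => [|[|[|//]]] _ em.
- rewrite addn0 in em; rewrite -em /anti anti_id mulrDr.
  suff h : std_span (odd (size U)) (xs (U ++ pivot_list i q) * (x m.+1 * v (m + 3))).
    exact: spanD.
  rewrite mulrA -xs1 -xs_cat (_ : m.+1 = (m + 3 - 2)%N); last lia.
  apply: std_span_second => //; split; [lia | | | |].
  + move=> m2; rewrite (ok_small _ okU) ?cat0s; last lia.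
    by rewrite (_ : q = 0%N) //; lia.
  + by move=> s /leP; lia.
  + move=> m4; rewrite mem_cat mem_pivot_list negb_or U0; lia.
  (* Now [m = 7] and [i = 1], with pivot letters 1, 2, 4, 5, so 0 and 3 come from [U]. First type
     excludes this; in second type [U] contains 5, which is then repeated. *)
  + move=> m7; rewrite !mem_cat !mem_pivot_list => h0 h3 _.
    have U0' : 0%N \in U by case/orP: h0 => //; lia.
    have U3 : 3%N \in U by case/orP: h3 => //; lia.
    have m7' : m = 7%N by lia.
    case: okU => [[_ _ h]|[T eT _]]; first exact: h.
    move: H; rewrite -catA cat_uniq => /and3P[_ /hasPn/(_ 5%N)].
    by rewrite eT m7' mem_cat mem_pivot_list !mem_cat !inE orbT; lia.
- have -> : m = (i + 3 * q).+1 by lia.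
  rewrite anti1 mulrN; apply: spanN.
  rewrite mulrA -xs1 -xs_cat; apply: std_span_first; last first.
    by rewrite size_cat addn1 /= szU negbK.
  move=> _; split.
  + by move=> s; rewrite mem_cat inE => /orP[/leP|/eqP ->]; lia.
  + move=> m2; rewrite (ok_small _ okU) ?cat0s; last lia.
    by rewrite mem_cat inE mem_pivot_list; lia.
  (* Now [m = 5] and [i = 1], with new letters 1, 2, 4, so [U] would contain both 0 and 3; no
     standard monomial of length 5 does. *)
  + move=> m5; rewrite !mem_cat !mem_pivot_list !inE => h0 h3.
    have U0' : 0%N \in U by case/orP: h0 => [/orP[]|] //; lia.
    have U3 : 3%N \in U by case/orP: h3 => [/orP[]|] //; lia.
    have m5' : m = 5%N by lia.
    case: okU => [[h _ _]|[T eT [_ h _ _ _]]].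
      by have := h _ U3; lia.
    by move: U0'; rewrite eT h m5'.
- have -> : m = (i + 3 * q).+2 by lia.
  rewrite anti2 mulrN; apply: spanN.
  rewrite !mulrA -!xs1 -!xs_cat; apply: std_span_first; last first.
    by rewrite !size_cat !addn1 /= -size_cat szU !negbK.
  move=> _; split.
  + move=> s; rewrite !(mem_cat s (_ ++ _)) !inE -orbA -orbA.
    by case/or4P => [/leP|/eqP ->|/eqP ->|/eqP ->]; lia.
  + by lia.
  + move=> m5; rewrite !mem_cat !mem_pivot_list !inE => h0 _.
    have /U0/negP nU : m = 4%N by lia.
    by case: nU; move: h0; case: (0%N \in U) => //=; lia.
Qed.

Lemma anti_std_span_lt i m : (m < i < 3)%N -> std_span false (anti i m).
Proof.
move=> lt; rewrite antiC; have [-> | ne] := eqVneq i m.+1.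
  rewrite anti1; apply/spanN; rewrite -xs1; apply: std_span_first => // _.
  by split=> [s||]; rewrite ?inE; lia.
have [-> ->] : i = 2%N /\ m = 0%N by lia.
rewrite anti2; apply/spanN.
have -> : x 0 * (x 1 * (x 2 * v (0 + 5))) = mon [:: 0; 1; 2]%N 5.
  by rewrite /mon !xs_cons xs_nil mulr1 !mulrA.
by apply: std_span_first => // _; split=> [s||]; rewrite ?inE; lia.
Qed.

(** A letter [j] is replaced by letters at most [j - 2], so the size bounds persist. First type
    stays first type; in second type, differentiating the letter [m - 2] gives first type and
    differentiating a letter of [T] keeps second type. *)
Lemma superder_std_span i m U : (i < 3)%N -> ok U m -> uniq U ->
  std_span (odd (size U)) (superder K i U * v m).
Proof.
move=> i3 okU uU; rewrite -[superder K i U]mul1r -xs_nil; 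
apply: span_superder => l1 j l2 eU le dv.
rewrite /= -/(mon _ _); set k := ((j - i) %/ 3)%N.
have ej : j = (i + 3 * k)%N by rewrite /k mulnC divnK // subnKC.
have sub s : s \in l1 ++ pivot_list i k ++ l2 ->
    (s \in l1 ++ l2) \/ [&& i <= s, s + 2 <= j & (s - i) %% 3 != 2]%N.
  rewrite !mem_cat mem_pivot_list -ej.
  by case/or3P => h; [left; rewrite h | right | left; rewrite h orbT].
have jl : j \notin l1 ++ l2.
  by move: uU; rewrite eU -cat1s uniq_catCA cat1s => /andP[].
have par : odd (size U) = ~~ odd (size (l1 ++ pivot_list i k ++ l2)).
  by rewrite eU !size_cat !oddD odd_size_pivot_list /= addbN.
have subU s : s \in l1 ++ l2 -> s \in U.
  by rewrite eU !mem_cat inE => /orP[-> //|->]; rewrite !orbT.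
have jU : j \in U by rewrite eU mem_cat inE eqxx orbT.
have ne s : s \in l1 ++ l2 -> s != j by apply: contraTneq => ->.
case: okU => [[h1 h2 h3]|[T eT [h0 h0' h1 h2 h3]]].
  apply: std_span_first => // _; have jm := h1 _ jU; split.
  - by move=> s /sub[/subU/h1|]; lia.
  - move=> m4; apply/negP => /sub[/subU|]; last lia.
    by apply/negP; apply: h2.
  (* A new 0 forces [i = 0] and [j = 3], so the letter 3 is gone; a new 3 would need [j >= 5],
     beyond the bound 4. *)
  - move=> m7 /sub[]; last first.
      by move=> hi /sub[/ne|]; lia.
    by move=> /subU U0 /sub[/subU/(h3 m7 U0)|]; lia.
have [e2 | [l2' e2]] : l2 = [::] \/ exists l2', l2 = l2' ++ [:: m - 2]%N.
  move: eU; rewrite eT; case/lastP: l2 {sub jl par subU ne} => [|l2' z]; first by left.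
  rewrite -cats1 -cat_cons catA !cats1 => /eqP; rewrite eqseq_rcons.
  move=> /andP[_ /eqP ->].
  by right; exists l2'; rewrite cats1.
  have [eT1 ej2] : T = l1 /\ (m - 2)%N = j.
    move: eU; rewrite eT e2 !cats1 => /eqP; rewrite eqseq_rcons.
    by move=> /andP[/eqP -> /eqP ->].
  apply: std_span_first => // _; split.
  - move=> s /sub[|]; last lia.
    by rewrite e2 cats0 -eT1 => /h1; lia.
  - move=> m4 ; apply/negP => /sub[|]; last lia.
    by rewrite e2 cats0 -eT1 h0' //; lia.
  - move=> m7 /sub[|]; last lia.
    by rewrite e2 cats0 -eT1 (negPf (h2 m7)).
have eT1 : T = l1 ++ j :: l2'.
  move: eU; rewrite eT e2 -cat_cons catA !cats1 => /eqP; rewrite eqseq_rcons.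
  by case/andP => /eqP.
have jT : j \in T by rewrite eT1 mem_cat inE eqxx orbT.
have subT s : s \in l1 ++ l2' -> s \in T /\ s != j.
  move=> sl; split; last first.
    by apply: ne; move: sl; rewrite e2 !mem_cat; case/orP=> ->; rewrite ?orbT.
  by move: sl; rewrite eT1 !mem_cat inE => /orP[-> //|->]; rewrite !orbT.
have {}sub s : s \in l1 ++ pivot_list i k ++ l2' ->
    (s \in T /\ s != j) \/ [&& i <= s, s + 2 <= j & (s - i) %% 3 != 2]%N.
  rewrite !mem_cat mem_pivot_list -ej.
  case/or3P => h; [left | by right | left]; apply: subT; rewrite mem_cat h ?orbT //.
have jm := h1 _ jT.
have e : l1 ++ pivot_list i k ++ l2 =
    (l1 ++ pivot_list i k ++ l2') ++ [:: m - 2]%N by rewrite e2 -!catA.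
rewrite par e; apply: std_span_second; last by rewrite size_cat addn1 /= negbK.
move=> _; split => //.
- by move=> m5; move: jT; rewrite h0'.
- by move=> s /sub[[/h1]|]; lia.
- move=> m7; apply/negP => /sub[[T0 _]|]; last lia.
  by move: (h2 m7); rewrite T0.
(* Since [j <= 5], the letter 5 is old and [j] is not 5; then 3 cannot be new and [j] is not 3; then
   0 cannot be new either. So [T] was already exceptional. *)
- move=> m10 a b c.
  have [T5 j5] : 5%N \in T /\ 5%N != j by case: (sub _ c) => //; lia.
  have [T3 j3] : 3%N \in T /\ 3%N != j by case: (sub _ b) => //; lia.
  have [T0 _] : 0%N \in T /\ 0%N != j by case: (sub _ a) => //; lia.
  exact: h3.
Qed.

Lemma ad_std i j : (i < 3)%N -> std_valid j ->
  std_span (~~ std_par j) (br true (std_par j) (v i) (stdA K j)).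
Proof.
move=> i3 val; have okj := std_ok val; have uj := std_list_uniq val.
rewrite /std_par negbK /stdA br_v; apply: spanD; first exact: superder_std_span.
apply: spanZ; have [le | lt] := leqP i j.1.2; first exact: anti_std_span.
have e : std_list j = [::] by apply: ok_small okj; lia.
by rewrite e xs_nil mul1r; apply: anti_std_span_lt; lia.
Qed.

Lemma ad_std_span i p b : (i < 3)%N -> std_span p b ->
  std_span (~~ p) (br true p (v i) b).
Proof.
move=> i3; move: b.
apply: (@span_ind _ _ _ _ (fun b => std_span (~~ p) (br true p (v i) b)))
  => [|a b Sa Sb|k a Sa|j /andP[val /eqP <-]].
- by rewrite br0r; apply: span0.
- by rewrite brDr; apply: spanD.
- by rewrite brZr; apply: spanZ.
exact: ad_std.
Qed.

Fixpoint levalA (w : lword) : lend K :=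
  match w with
  | LGen i => v i
  | LBr a b => br (lpar a) (lpar b) (levalA a) (levalA b)
  end.

Lemma levalAE w p : levalA w p = leval K w p.
Proof.
elim: w p => [i|a IHa b IHb] p /=; first exact: opvE.
rewrite /br /sbr lend_addE lend_oppE lend_scaleE !lend_mulE.
by rewrite !(IHa, IHb).
Qed.

Lemma ad_word w p b : std_span p b ->
  std_span (lpar w (+) p) (br (lpar w) p (levalA w) b).
Proof.
elim: w p b => [i|w1 IH1 w2 IH2] p b Sb /=; first exact: ad_std_span.
rewrite jacobi; apply: spanD; last apply/spanN/spanZ.
  by rewrite -addbA; apply: IH1; apply: IH2.
by rewrite [lpar w1 (+) _]addbC -addbA; apply: IH2; apply: IH1.
Qed.

Lemma levalA_std_span w : std_span (lpar w) (levalA w).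
Proof.
elim: w => [i|w1 IH1 w2 IH2] /=; last exact: ad_word.
have := @std_span_first K [::] i true; rewrite /mon xs_nil mul1r; by apply.
Qed.

End Closure.

(** * Generation of the standard monomials *)

Section Generation.
Variable K : fieldType.
Hypothesis hK : ~~ (2%N \in [pchar K]).
Local Notation x := (opx K).
Local Notation v := (opv K).
Local Notation xs := (xs K).
Local Notation mon := (mon K).
Local Notation anti := (anti K).

Definition word_span p := lspan (levalA K) (fun w => lpar w == p).

Lemma word_span_br p q a b : word_span p a -> word_span q b ->
  word_span (p (+) q) (br p q a b).
Proof.
move=> Qa Qb; move: a Qa.
apply: (@span_ind _ _ _ _ (fun a => word_span (p (+) q) (br p q a b)))
  => [|a1 a2 Q1 Q2|k a Qa|w1 /eqP e1].
- by rewrite br0l; apply: span0.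
- by rewrite brDl; apply: spanD.
- by rewrite brZl; apply: spanZ.
move: b Qb; apply: (@span_ind _ _ _ _ (fun b => word_span (p (+) q) (br p q _ b)))
  => [|b1 b2 Q1 Q2|k b Qb|w2 /eqP e2].
- by rewrite br0r; apply: span0.
- by rewrite brDr; apply: spanD.
- by rewrite brZr; apply: spanZ.
rewrite -e1 -e2; apply: (@span_gen _ _ (levalA K) _ (LBr w1 w2)).
by rewrite /= eqxx.
Qed.

Definition word_mon l n := word_span (~~ odd (size l)) (mon l n).

Lemma word_mon_perm l1 l2 n : perm_eq l1 l2 -> word_mon l1 n -> word_mon l2 n.
Proof.
by move=> e; rewrite /word_mon (perm_size e); apply: span_mon_perm.
Qed.

Lemma word_mon_anti l1 n l2 m : word_mon l1 n -> word_mon l2 m ->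
  all (fun j => j < m)%N l1 -> all (fun j => j < n)%N l2 ->
  word_span (odd (size (l1 ++ l2))) (xs (l1 ++ l2) * anti n m).
Proof.
move=> Q1 Q2 lt1 lt2; have := word_span_br Q1 Q2; rewrite br_mon // => /span_sign.
by rewrite addbN addNb negbK size_cat oddD.
Qed.

(** The bracket carries the factor 2 of [anti n n], which the hypothesis on the characteristic
    allows to be divided out. *)
Lemma word_mon_br0 l1 n l2 : word_mon l1 n -> word_mon l2 n ->
  all (fun j => j < n)%N l1 -> all (fun j => j < n)%N l2 ->
  word_mon ((l1 ++ l2) ++ [:: n.+1]) (n + 3).
Proof.
move=> Q1 Q2 lt1 lt2; have := word_mon_anti Q1 Q2 lt1 lt2.
move: (l1 ++ l2) => l.
rewrite /anti anti_id -mulr2n -scaler_nat -scalerAr /word_mon size_cat addn1 /= negbK.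
rewrite /mon [xs (_ ++ [:: _])]xs_cat xs1 !mulrA; apply: spanZ_inv.
by apply: contraNneq hK => e; rewrite inE /= e eqxx.
Qed.

Lemma word_mon_br1 l1 n l2 : word_mon l1 n -> word_mon l2 n.+1 ->
  all (fun j => j < n.+1)%N l1 -> all (fun j => j < n)%N l2 ->
  word_mon ((l1 ++ l2) ++ [:: n]) (n + 3).
Proof.
move=> Q1 Q2 lt1 lt2; have := word_mon_anti Q1 Q2 lt1 lt2.
move: (l1 ++ l2) => l.
rewrite anti1 mulrN => /spanN; rewrite opprK /word_mon size_cat addn1 /= negbK.
by rewrite /mon [xs (_ ++ [:: _])]xs_cat xs1 !mulrA.
Qed.

Lemma word_mon_br2 l1 n l2 : word_mon l1 n -> word_mon l2 n.+2 ->
  all (fun j => j < n.+2)%N l1 -> all (fun j => j < n)%N l2 ->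
  word_mon ((l1 ++ l2) ++ [:: n; n.+1; n.+2]) (n + 5).
Proof.
move=> Q1 Q2 lt1 lt2; have := word_mon_anti Q1 Q2 lt1 lt2.
move: (l1 ++ l2) => l.
rewrite anti2 mulrN => /spanN; rewrite opprK /word_mon size_cat addn3 /= !negbK.
by rewrite /mon [xs (_ ++ [:: _, _ & _])]xs_cat !xs_cons xs_nil mulr1 !mulrA.
Qed.

(** Three consecutive pivots are carried along: squaring [v n] yields [x n.+1 * v n.+3], and
    bracketing with [v n.+1] strips the letter. *)
Lemma word_mon_v_sq n :
  (word_mon [::] n /\ word_mon [::] n.+1) /\ word_mon [::] n.+2.
Proof.
have gen n' : (n' < 3)%N -> word_mon [::] n'.
  move=> n3; rewrite /word_mon /mon xs_nil mul1r.
  exact: (@span_gen _ _ (levalA K) (fun w => lpar w == true) (LGen (Ordinal n3))).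
elim: n => [|n [[Q0 Q1] Q2]]; first by do !split; apply: gen.
do !split=> //; have := word_mon_br0 Q0 Q0 isT isT; rewrite /= addn3 => Qx.
have : word_span true (br true false (v n.+1) (mon [:: n.+1] n.+3)).
  by have := word_span_br Q1 Qx; rewrite {1}/mon xs_nil mul1r.
by rewrite (@br_remove K n.+1 [::] n.+3).
Qed.

Lemma word_mon_v n : word_mon [::] n.
Proof. by case: (word_mon_v_sq n) => [[]]. Qed.

Lemma word_mon_sq n : word_mon [:: n.+1] (n + 3).
Proof. exact: (word_mon_br0 (word_mon_v n) (word_mon_v n)). Qed.

Lemma word_mon_remove i l m : word_mon (i :: l) m -> (i < m)%N -> i \notin l ->
  word_mon l m.
Proof.
move=> Ql lt il; have := word_span_br (word_mon_v i) Ql.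
by rewrite {1}/mon xs_nil mul1r /= !negbK br_remove.
Qed.

Lemma word_mon_sub l l' m : word_mon l m -> uniq l -> all (fun j => j < m)%N l ->
  uniq l' -> {subset l' <= l} -> word_mon l' m.
Proof.
move=> Ql ul ltl ul' sub.
(* The letters to be discarded are moved to the front, where [word_mon_remove] strips them one by
   one. *)
have e : perm_eq l ([seq i <- l | i \notin l'] ++ l').
  apply: uniq_perm => // [|i].
    rewrite cat_uniq filter_uniq // ul' andbT /=.
    by apply/hasPn => i il'; rewrite mem_filter il'.
  rewrite mem_cat mem_filter; case: (boolP (i \in l')) => [/sub|] //=.
  by rewrite orbF.
have u : uniq ([seq i <- l | i \notin l'] ++ l') by rewrite -(perm_uniq e).
have lt : all (fun j => j < m)%N ([seq i <- l | i \notin l'] ++ l').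
  by rewrite -(perm_all _ e).
move: (word_mon_perm e Ql) u lt; elim: (filter _ _) => [//|i r IH] /= Q.
move=> /andP[ir u] /andP[lt lts]; apply: IH => //.
exact: word_mon_remove Q lt ir.
Qed.

Lemma word_mon_top4 : word_mon [:: 1]%N 4.
Proof. exact: (word_mon_br1 (word_mon_v 1) (word_mon_v 2)). Qed.

Lemma word_mon_top5 : word_mon [:: 0; 1; 2]%N 5.
Proof. exact: (word_mon_br2 (word_mon_v 0) (word_mon_v 2)). Qed.

(** A first-type monomial of length 7 misses 0 or misses 3, so there are two maximal ones: this and
    the one in [word_mon_top7']. *)
Lemma word_mon_top7 : word_mon [:: 1; 2; 3; 4]%N 7.
Proof. exact: (word_mon_br2 (word_mon_v 2) word_mon_top4). Qed.

Lemma word_mon_top7' : word_mon [:: 0; 1; 2; 4]%N 7.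
Proof. exact: (word_mon_br1 (word_mon_v 4) word_mon_top5). Qed.

(** The general recursion would start from the full tail of [v 7], which is exceptional; the missing
    letter 3 is supplied by [x 3 * v 5] instead. *)
Lemma word_mon_top10 : word_mon (iota 0 8) 10.
Proof.
have := word_mon_br2 (word_mon_sq 2 : word_mon [:: 3%N] 5) word_mon_top7' isT isT.
by apply: word_mon_perm.
Qed.

Lemma word_mon_top m : (2 < m)%N -> m != 4%N -> m != 7%N ->
  word_mon (iota 0 (m - 2)) m.
Proof.
elim/ltn_ind: m => m IH m3 m4 m7.
have [-> | n3] := eqVneq m 3%N.
  exact: (word_mon_br1 (word_mon_v 0) (word_mon_v 1)).
have [-> | n5] := eqVneq m 5%N; first exact: word_mon_top5.
have [-> | n10] := eqVneq m 10%N; first exact: word_mon_top10.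
(* The bracket of [v (m - 5)] with the full monomial of length [m - 3] adjoins the letters [m - 5],
   [m - 4], [m - 3]. The cases [m = 7] and [m = 10] are gone, so [m - 3] is neither 4 nor 7. *)
have [k em] : exists k, m = k + 6 by exists (m - 6)%N; lia.
have Q : word_mon (iota 0 k.+1) k.+3.
  by have := IH k.+3; rewrite subn2 /=; apply; lia.
have := word_mon_br2 (word_mon_v k.+1) Q isT.
rewrite (_ : k.+1 + 5 = m)%N; last lia.
rewrite (_ : m - 2 = k.+1 + 3)%N; last lia.
rewrite iotaD; apply; apply/allP => s.
by rewrite mem_iota; lia.
Qed.

Lemma first_ok_word l n : uniq l -> first_ok l n -> word_mon l n.
Proof.
move=> ul [h1 h2 h3]; have [n2 | n3] := leqP n 2.
  case: l ul h1 {h2 h3} => [|s l] _ h1; first exact: word_mon_v.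
  by have := h1 s (mem_head _ _); lia.
have [n4 | n4] := eqVneq n 4%N.
  subst n; apply: (word_mon_sub word_mon_top4) => // s sl.
  have := h1 s sl; have : s != 0%N by apply: contraNneq (h2 erefl) => <-.
  by rewrite inE; lia.
have [n7 | n7] := eqVneq n 7%N.
  subst n; have [l0 | l0] := boolP (0%N \in l).
    apply: (word_mon_sub word_mon_top7') => // s sl.
    have := h1 s sl; have : s != 3%N by apply/eqP => e; apply: h3; rewrite -?e.
    by rewrite !inE; lia.
  apply: (word_mon_sub word_mon_top7) => // s sl.
  have := h1 s sl; have : s != 0%N by apply: contraNneq l0 => <-.
  by rewrite !inE; lia.
apply: (word_mon_sub (word_mon_top n3 n4 n7)); rewrite ?iota_uniq //.
  by apply/allP => s; rewrite mem_iota; lia.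
by move=> s /h1; rewrite mem_iota; lia.
Qed.

(** Second type arises from two monomials over the same pivot [v n]: their bracket produces the
    distinguished letter [n.+1], and the desired tail only has to be covered by [l1] and [l2]
    together. *)
Lemma word_mon_second n l1 l2 : word_mon l1 n -> word_mon l2 n ->
  uniq ((l1 ++ l2) ++ [:: n.+1]) ->
  all (fun j => j < n)%N l1 -> all (fun j => j < n)%N l2 ->
  forall T, uniq (T ++ [:: n.+1]) -> {subset T <= l1 ++ l2} ->
  word_mon (T ++ [:: n.+1]) (n + 3).
Proof.
move=> Q1 Q2 u lt1 lt2 T uT sub.
apply: (word_mon_sub (word_mon_br0 Q1 Q2 lt1 lt2)) => //.
  rewrite !all_cat /= andbT; apply/andP; split; last lia.
  rewrite -all_cat; apply: sub_all (_ : all (fun j => j < n)%N _) => [s|].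
    by lia.
  by rewrite all_cat lt1.
by move=> s; rewrite !(mem_cat s _ [:: n.+1]) => /orP[/sub ->|->] //; rewrite orbT.
Qed.

Lemma second_ok_word T n : uniq (T ++ [:: n - 2]%N) -> second_ok T n ->
  word_mon (T ++ [:: n - 2]%N) n.
Proof.
move=> uT [n3 h0 h1 h2 h3].
have [n5 | n6] := leqP n 5.
  rewrite h0 // (_ : n - 2 = (n - 3).+1)%N; last lia.
  by have := word_mon_sq (n - 3); rewrite subnK.
have [k en] : exists k, n = k.+3 + 3 by exists (n - 6)%N; lia.
have e2 : (n - 2 = k.+4)%N by lia.
rewrite e2 en in uT *.
(* This factor supplies the letter [n - 5], which is too large for a first-type tail over
   [v k.+3]. *)
have sq : word_mon [:: k.+1] k.+3 by have := word_mon_sq k; rewrite addn3.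
have [n7 | n7] := eqVneq n 7%N.
  have ek : k = 1%N by lia.
  subst k; apply: (word_mon_second word_mon_top4 sq) => // s sT.
  have := h1 s sT; have : s != 0%N by apply: contraNneq (h2 n7) => <-.
  by rewrite !inE; lia.
(* Over [v 7] the tail misses one of 0, 3, 5. The letters are covered accordingly by 1, 2, 3, 4 with
   5, by 0, 1, 2, 4 with 5, or by 3 with 0, 1, 2, 4. *)
have [n10 | n10] := eqVneq n 10%N.
  have ek : k = 4%N by lia.
  subst k.
  have [T0 | T0] := boolP (0%N \in T); last first.
    apply: (word_mon_second word_mon_top7 sq) => // s sT.
    have := h1 s sT; have : s != 0%N by apply: contraNneq T0 => <-.
    by rewrite !inE; lia.
  have [T3 | T3] := boolP (3%N \in T); last first.
    apply: (word_mon_second word_mon_top7' sq) => // s sT.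
    have := h1 s sT; have : s != 3%N by apply: contraNneq T3 => <-.
    by rewrite !inE; lia.
  have Q3 : word_mon [:: 3%N] 7.
    by apply: (word_mon_sub word_mon_top7) => // s; rewrite inE => /eqP ->.
  apply: (word_mon_second Q3 word_mon_top7') => // s sT.
  have := h1 s sT; have : s != 5%N.
    by apply/eqP => e; apply: (h3 n10 T0 T3); rewrite -e.
  by rewrite !inE; lia.
have Q : word_mon (iota 0 k.+1) k.+3.
  by have := @word_mon_top k.+3; rewrite subn2 /=; apply; lia.
apply: (word_mon_second Q sq) => //.
- have -> : iota 0 k.+1 ++ [:: k.+1] = iota 0 k.+2.
    by rewrite -[k.+2]addn1 iotaD.
  by rewrite cats1 rcons_uniq iota_uniq mem_iota; lia.
- by apply/allP => s; rewrite (mem_iota 0 k.+1); lia.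
- by rewrite /=; lia.
- by move=> s /h1; rewrite mem_cat (mem_iota 0 k.+1) inE; lia.
Qed.

Lemma stdA_word_span j : std_valid j -> word_span (std_par j) (stdA K j).
Proof.
move=> val; have := std_list_uniq val; case: j val => [[[] n] T].
  by move=> /std_valid2P h u; apply: second_ok_word.
by move=> /std_valid1P h; rewrite /stdA /std_par /= cats0 => u; apply: first_ok_word.
Qed.

End Generation.

(** * Linear independence *)

Section Independence.
Variable K : fieldType.
Local Notation x := (opx K).
Local Notation v := (opv K).
Local Notation xs := (xs K).

Lemma v_xmon1_gt m n : (n < m)%N -> v m (xmon K [fset n]) = 0.
Proof.
move=> lt; rewrite (@v_xmon K m _ _ (leqnn _)) big1 // => k _.
by rewrite d_xmon ifN ?lend_fun0 // inE; lia.
Qed.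

Lemma v_xmon1 n : v n (xmon K [fset n]) = xmon K fset0.
Proof.
have -> : xmon K [fset n] = x n (xmon K fset0).
  by rewrite x_xmon inE /nbelow /= scale1r fsetU0.
rewrite -lend_mulE vx_id lend_addE lend_oppE lend_oneE lend_mulE.
rewrite (@v_xmon K n _ _ (leqnn _)) big1 ?lend_fun0 ?subr0 // => k _.
by rewrite d_xmon inE lend_fun0.
Qed.

Lemma xs_xmon0 l : uniq l -> exists k : nat,
  xs l (xmon K fset0) = (-1) ^+ k *: xmon K [fset s in l].
Proof.
elim: l => [|i l IH] /=.
  exists 0%N; rewrite xs_nil lend_oneE scale1r; congr (xmon K _).
  by apply/fsetP => s; rewrite !inE.
move=> /andP[il /IH[k e]]; rewrite xs_cons lend_mulE e lend_funZ x_xmon.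
rewrite inE /= (negPf il) scalerA -exprD; eexists; congr (_ *: xmon K _).
by apply/fsetP => s; rewrite !inE.
Qed.

Lemma std_list_inj j1 j2 : std_valid j1 -> std_valid j2 -> j1.1.2 = j2.1.2 ->
  std_list j1 =i std_list j2 -> j1 = j2.
Proof.
move=> val1 val2; have u1 := std_list_uniq val1; have u2 := std_list_uniq val2.
(* The type can be read off from the letters, since first-type tails stop at [n - 3]. *)
have tagE j : std_valid j -> j.1.1 = (j.1.2 - 2 \in std_list j)%N.
  case: j => [[[] n] T] /=; first by move=> _; rewrite mem_cat mem_seq1 eqxx orbT.
  move/std_valid1P => [h _ _]; rewrite cats0; apply/esym/negbTE/negP => /h.
  lia.
move=> en eqm; have et : j1.1.1 = j2.1.1 by rewrite !tagE // en eqm.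
case: j1 j2 {val1 val2 tagE} u1 u2 en et eqm => [[t n] T1] [[t' n'] T2] /=.
move=> u1 u2 en et eqm; subst n' t'; congr (_, _, _); apply/fsetP => s.
have := eqm s; rewrite !mem_cat !mem_sort; case: t u1 u2 {eqm}; last by rewrite !orbF.
rewrite mem_seq1 !cats1 !rcons_uniq !mem_sort => /andP[n1 _] /andP[n2 _].
by case: eqVneq => [->|_]; rewrite ?orbF // (negPf n1) (negPf n2).
Qed.

Lemma stdA_free (s : seq std) (c : std -> K) :
  uniq s -> all std_valid s ->
  (forall p : Lam K, \sum_(j <- s) c j *: stdA K j p = 0) ->
  forall j, j \in s -> c j = 0.
Proof.
move=> us /allP vs rel j; move: {-2}j.1.2 (erefl j.1.2) => n; move: j.
elim/ltn_ind: n => n IH j ej js.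
pose T0 := [fset i in std_list j].
(* At the generator of index [n], longer monomials vanish, shorter ones have zero coefficient by
   induction, and those of length [n] give distinct basis monomials up to sign. The coefficient at
   [T0] therefore isolates [c j]. *)
have := congr1 (mcoeff T0) (rel (xmon K [fset n])).
rewrite mcoeff0 raddf_sum (bigD1_seq j) //=.
rewrite big1_seq ?addr0 => [|j' /andP[ne j's]].
  rewrite mcoeffZ /stdA /mon lend_mulE ej v_xmon1.
  have [k ->] := xs_xmon0 (std_list_uniq (vs j js)).
  rewrite mcoeffZ mcoeffUU mulr1 => /eqP.
  by rewrite mulf_eq0 signr_eq0 orbF => /eqP.
rewrite mcoeffZ; case: (ltngtP j'.1.2 n) => [lt|gt|e].
- by rewrite (IH _ lt) ?mul0r.
- by rewrite /stdA /mon lend_mulE v_xmon1_gt ?lend_fun0 ?mcoeff0 ?mulr0.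
rewrite /stdA /mon lend_mulE e v_xmon1.
have [k ->] := xs_xmon0 (std_list_uniq (vs _ j's)).
rewrite mcoeffZ mcoeffU; case: eqP => [eT|_]; last by rewrite !mulr0.
case/eqP: ne; apply: std_list_inj; rewrite ?vs ?e ?ej // => i.
by have /fsetP/(_ i) := eT; rewrite !inE.
Qed.

End Independence.

(* Q = span of all iterated supercommutators of v_0, v_1, v_2.
   The standard monomials form a basis of Q:
   (1) they are linearly independent, (2) each lies in Q,
   (3) every element of Q (equivalently every iterated bracket) is a
   linear combination of them. *)
Theorem theorem5p1 (K : fieldType) (hK : ~~ (2%N \in [pchar K])) :
  [/\ (forall (s : seq std) (c : std -> K),
         uniq s -> all std_valid s ->
         (forall p : Lam K, \sum_(j <- s) c j *: std_op K j p = 0) ->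
         forall j, j \in s -> c j = 0),
      (forall j : std, std_valid j ->
         exists ws : seq (K * lword),
           forall p : Lam K, std_op K j p = \sum_(w <- ws) w.1 *: leval K w.2 p)
    & (forall w : lword,
         exists js : seq (K * std),
           all (fun j => std_valid j.2) js /\
           forall p : Lam K, leval K w p = \sum_(j <- js) j.1 *: std_op K j.2 p)].
Proof.
split.
- move=> s c us vs rel; apply: stdA_free us vs _ => p.
  by rewrite -[RHS](rel p); apply: eq_bigr => j _; rewrite stdAE.
- move=> j /(stdA_word_span hK)[ws [_ e]]; exists ws => p.
  rewrite -stdAE e lend_sumE; apply: eq_bigr => w _.
  by rewrite lend_scaleE levalAE.
- move=> w; have [js [val e]] := levalA_std_span K w; exists js; split.
    by apply: sub_all val => j /andP[].
  move=> p; rewrite -levalAE e lend_sumE; apply: eq_bigr => j _.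
  by rewrite lend_scaleE stdAE.
Qed.
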